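(* Let $F=\mathbb{Q}(\sqrt{-7})\subset\mathbb{C}$ and let $$w_{12}=\tfrac38+\tfrac{\sqrt7}{8}i,\quad w_{21}=\tfrac54+\tfrac{\sqrt7}{4}i,\quad w_{34}=\tfrac38-\tfrac{\sqrt7}{8}i,\quad w_{43}=\tfrac54-\tfrac{\sqrt7}{4}i,$$ $$t_{12}=\tfrac32+\tfrac{\sqrt7}{2}i,\quad t_{21}=-\tfrac14-\tfrac{\sqrt7}{4}i,\quad t_{34}=\tfrac32-\tfrac{\sqrt7}{2}i,\quad t_{43}=-\tfrac14+\tfrac{\sqrt7}{4}i.$$ Let $$\beta_1(K)=2([w_{12}]+[w_{21}]+[w_{34}]+[w_{43}]),\qquad \beta_2(K)=2([t_{12}]+[t_{21}]+[t_{34}]+[t_{43}])$$ in $\mathcal{P}(F)$. Then: (1) $\beta_1(K)=-2c_F$ in $\mathcal{P}(F)$. (2) $\beta_2(K)=0$ in $\mathcal{P}(F)$. (3) $\beta_1(K)\in\mathcal{B}(F)$ is a non-trivial torsion element of order $3$.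
   Context: Pre-Bloch group: for a field $F$, $\mathcal{P}(F)$ is the quotient of the free abelian group $\mathbb{Z}[F\setminus\{0,1\}]$ by the subgroup generated by $[x]-[y]+[\frac{y}{x}]-[\frac{1-x^{-1}}{1-y^{-1}}]+[\frac{1-x}{1-y}]$ for $x\neq y$ in $F\setminus\{0,1\}$. $\bigwedge^2F^*$ is $F^*\otimes_{\mathbb{Z}}F^*$ modulo the subgroup generated by all $x\otimes y+y\otimes x$. The Bloch group $\mathcal{B}(F)$ is the kernel of $\delta:\mathcal{P}(F)\to\bigwedge^2F^*$, $\delta([z])=z\wedge(1-z)$. $c_F:=[x]+[1-x]\in\mathcal{B}(F)$, which is independent of the choice of $x\in F\setminus\{0,1\}$ (known result of Suslin). The elements $\beta_1(K),\beta_2(K)$ are the invariants attached to two representations of the fundamental group of the figure eight knot complement $K$ into $PU(2,1)$ coming from gluing two CR tetrahedra with the indicated cross-ratios. *)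

(* Defs.v *)
From HB Require Import structures.
From mathcomp Require Import all_boot all_order all_algebra all_field.
From mathcomp Require Import boolp classical_sets.
From mathcomp Require Import freeg.
From mathcomp Require Import ring.

Set Implicit Arguments.
Unset Strict Implicit.
Unset Printing Implicit Defensive.

Import Order.TTheory GRing.Theory Num.Theory.
Import ring_quotient.Quotient.

Local Open Scope ring_scope.
Local Open Scope quotient_scope.

Section GeneratedSubgroup.
Variables (G : zmodType) (A : set G).

Definition gen_subgroup : {pred G} :=
  fun x => `[< forall S : zmodClosed G, (forall a, A a -> a \in S) -> x \in S >].

Lemma gen_subgroup_zmod : zmod_closed gen_subgroup.
Proof.
split=> [|x y /asboolP xS /asboolP yS]; apply/asboolP => S AS; first exact: rpred0.
by rewrite rpredB ?xS ?yS.
Qed.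
HB.instance Definition _ :=
  GRing.isZmodClosed.Build G gen_subgroup gen_subgroup_zmod.

Lemma mem_gen a : A a -> a \in gen_subgroup.
Proof. by move=> Aa; apply/asboolP => S; apply. Qed.

Definition zquot := (quot gen_subgroup).
HB.instance Definition _ := GRing.Zmodule.on zquot.

Definition zproj (x : G) : zquot := \pi_(quot gen_subgroup) x.

Lemma zproj_is_zmod_morphism : zmod_morphism zproj.
Proof. by move=> x y; rewrite /zproj !piE. Qed.
HB.instance Definition _ :=
  GRing.isZmodMorphism.Build G zquot zproj zproj_is_zmod_morphism.

Lemma zproj_rel a : A a -> zproj a = 0.
Proof.
move=> Aa; rewrite /zproj -(raddf0 zproj); apply/eqP.
by rewrite -idealrBE subr0 mem_gen.
Qed.

Variables (M : zmodType) (f : {additive G -> M}).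

(* The map induced by f on the quotient; meaningful when f kills A, which is
   the hypothesis of zliftE. *)
Definition zlift (q : zquot) : M := f (repr (q : (quot gen_subgroup))).

Hypothesis fA : forall a, A a -> f a = 0.

Lemma gen_kernel x : x \in gen_subgroup -> f x = 0.
Proof.
pose K : {pred G} := fun x => f x == 0.
have Kz : zmod_closed K.
  split=> [|u v /eqP fu /eqP fv]; rewrite /in_mem /= /K ?raddf0 //.
  by rewrite raddfB fu fv subr0.
pose KS := GRing.isZmodClosed.Build G K Kz.
pose KC : zmodClosed G := HB.pack K KS.
by move/asboolP/(_ KC)=> xK; apply/eqP/xK => a /fA /eqP.
Qed.

Lemma zliftE x : zlift (zproj x) = f x.
Proof.
apply/eqP; rewrite -subr_eq0 -raddfB; apply/eqP/gen_kernel.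
by rewrite idealrBE reprK.
Qed.

Lemma zlift_is_zmod_morphism : zmod_morphism zlift.
Proof.
move=> p q; have Ep (r : zquot) : r = zproj (repr (r : (quot gen_subgroup))).
  by rewrite /zproj reprK.
by rewrite [in LHS](Ep p) [in LHS](Ep q) -raddfB zliftE raddfB.
Qed.

End GeneratedSubgroup.

Section FreeLift.
Variables (T : choiceType) (M : zmodType) (f : T -> M).

(* The additive extension of f to the free abelian group on T; M is viewed as
   a module over int, as required by fglift. *)
Definition free_lift (D : {freeg T}) : M :=
  @fglift int (zmodule M) T (f : T -> zmodule M) D.

Lemma free_lift_is_zmod_morphism : zmod_morphism free_lift.
Proof. exact: (@lift_is_additive int T (zmodule M)). Qed.
HB.instance Definition _ :=
  GRing.isZmodMorphism.Build {freeg T} M free_lift free_lift_is_zmod_morphism.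

Lemma free_liftU x : free_lift << x >> = f x.
Proof. by rewrite /free_lift liftU scale1r. Qed.

End FreeLift.

Section Tensor.
Variable A : zmodType.

Definition tensor_rel : set {freeg (A * A)} :=
  [set r | (exists x y z : A, r = << (x + y, z) >> - << (x, z) >> - << (y, z) >>)
        \/ (exists x y z : A, r = << (x, y + z) >> - << (x, y) >> - << (x, z) >>)]%classic.

Definition tensor := zquot tensor_rel.
HB.instance Definition _ := GRing.Zmodule.on tensor.

Definition tens (x y : A) : tensor := zproj tensor_rel << (x, y) >>.

(* Only x \otimes y + y \otimes x is killed, hence 2 (x \wedge x) = 0 but
   x \wedge x need not vanish. *)
Definition wedge2_rel : set tensor :=
  [set t | exists x y : A, t = tens x y + tens y x]%classic.

Definition wedge2 := zquot wedge2_rel.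
HB.instance Definition _ := GRing.Zmodule.on wedge2.

Definition wedge (x y : A) : wedge2 := zproj wedge2_rel (tens x y).

Lemma wedgeDl x y z : wedge (x + y) z = wedge x z + wedge y z.
Proof.
rewrite /wedge -raddfD; congr (zproj _ _); apply/eqP; rewrite -subr_eq0 opprD addrA.
rewrite /tens -!raddfB /= zproj_rel //; left; by exists x, y, z.
Qed.

Lemma wedgeDr x y z : wedge x (y + z) = wedge x y + wedge x z.
Proof.
rewrite /wedge -raddfD; congr (zproj _ _); apply/eqP; rewrite -subr_eq0 opprD addrA.
rewrite /tens -!raddfB /= zproj_rel //; right; by exists x, y, z.
Qed.

Lemma wedge_anti x y : wedge x y + wedge y x = 0.
Proof. by rewrite /wedge -raddfD /= zproj_rel //; exists x, y. Qed.

Lemma wedgeC x y : wedge x y = - wedge y x.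
Proof. by apply/eqP; rewrite -addr_eq0 wedge_anti. Qed.

Lemma wedgeNl x y : wedge (- x) y = - wedge x y.
Proof.
apply/eqP; rewrite -addr_eq0 -wedgeDl addNr.
by rewrite -(inj_eq (addrI (wedge 0 y))) -wedgeDl !addr0.
Qed.

Lemma wedgeNr x y : wedge x (- y) = - wedge x y.
Proof. by rewrite wedgeC wedgeNl opprK wedgeC. Qed.

End Tensor.

(* The multiplicative group F^*, as an abelian group written additively: for
   u v : Fstar F, u + v is the product in F and - u is the inverse. *)
Section Fstar.
Variable F : fieldType.

Definition Fstar := {x : F | x != 0}.
HB.instance Definition _ := Choice.on Fstar.

Definition star (x : F) (x0 : x != 0) : Fstar := exist _ x x0.

Fact Fstar_mul_subproof (u v : Fstar) : val u * val v != 0.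
Proof. by rewrite mulf_neq0 ?(valP u) ?(valP v). Qed.
Fact Fstar_inv_subproof (u : Fstar) : (val u)^-1 != 0.
Proof. by rewrite invr_neq0 ?(valP u). Qed.

Definition Fstar_one : Fstar := star (oner_neq0 F).
Definition Fstar_mul (u v : Fstar) : Fstar := star (Fstar_mul_subproof u v).
Definition Fstar_inv (u : Fstar) : Fstar := star (Fstar_inv_subproof u).

Fact Fstar_mulA : associative Fstar_mul.
Proof. by move=> u v w; apply: val_inj; rewrite /= mulrA. Qed.
Fact Fstar_mulC : commutative Fstar_mul.
Proof. by move=> u v; apply: val_inj; rewrite /= mulrC. Qed.
Fact Fstar_mul1 : left_id Fstar_one Fstar_mul.
Proof. by move=> u; apply: val_inj; rewrite /= mul1r. Qed.
Fact Fstar_mulV : left_inverse Fstar_one Fstar_inv Fstar_mul.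
Proof. by move=> u; apply: val_inj; rewrite /= mulVf ?(valP u). Qed.
HB.instance Definition _ :=
  GRing.isZmodule.Build Fstar Fstar_mulA Fstar_mulC Fstar_mul1 Fstar_mulV.

Lemma val_FstarD (u v : Fstar) : val (u + v) = val u * val v.
Proof. by []. Qed.
Lemma val_FstarN (u : Fstar) : val (- u) = (val u)^-1.
Proof. by []. Qed.

End Fstar.

Section Bloch.
Variable F : fieldType.
Implicit Types x y : F.

Definition F01 := {x : F | (x != 0) && (x != 1)}.
HB.instance Definition _ := Choice.on F01.

(* The generator [x] of Z[F \ {0, 1}], extended by 0 to x = 0 and x = 1.  The
   junk values are never used: see five_term_args. *)
Definition fgen x : {freeg F01} :=
  if insub x is Some u then << (u : F01) >> else 0.

Definition five_term x y : {freeg F01} :=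
  fgen x - fgen y + fgen (y / x) - fgen ((1 - x^-1) / (1 - y^-1))
  + fgen ((1 - x) / (1 - y)).

Definition five_term_rel : set {freeg F01} :=
  [set r | exists x y, [/\ x != 0, x != 1, y != 0, y != 1 & x != y]
                       /\ r = five_term x y]%classic.

Definition preBloch := zquot five_term_rel.
HB.instance Definition _ := GRing.Zmodule.on preBloch.

Definition bracket x : preBloch := zproj five_term_rel (fgen x).

Lemma five_term_args x y :
  [/\ x != 0, x != 1, y != 0, y != 1 & x != y] ->
  [/\ (y / x != 0) && (y / x != 1),
      ((1 - x^-1) / (1 - y^-1) != 0) && ((1 - x^-1) / (1 - y^-1) != 1)
    & ((1 - x) / (1 - y) != 0) && ((1 - x) / (1 - y) != 1)].
Proof.
case=> x0 x1 y0 y1 xy.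
have c0 : 1 - x != 0 by rewrite subr_eq0 eq_sym.
have d0 : 1 - y != 0 by rewrite subr_eq0 eq_sym.
have xi : 1 - x^-1 != 0 by rewrite subr_eq0 eq_sym invr_eq1.
have yi : 1 - y^-1 != 0 by rewrite subr_eq0 eq_sym invr_eq1.
have div1 (a b : F) : b != 0 -> (a / b == 1) = (a == b).
  by move=> b0; rewrite -(inj_eq (mulIf b0)) divfK // mul1r.
rewrite !div1 // !mulf_neq0 ?invr_eq0 //= ![1 - _ == _](inj_eq (addrI 1)).
by rewrite !eqr_opp (inj_eq invr_inj) xy eq_sym xy.
Qed.

Lemma bracket_five_term x y :
  [/\ x != 0, x != 1, y != 0, y != 1 & x != y] ->
  bracket x - bracket y + bracket (y / x)
  - bracket ((1 - x^-1) / (1 - y^-1)) + bracket ((1 - x) / (1 - y)) = 0.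
Proof.
move=> xy; rewrite /bracket -!(raddfB, raddfD) /= zproj_rel //.
by exists x, y.
Qed.

Fact F01_neq0 (u : F01) : val u != 0.
Proof. by case/andP: (valP u). Qed.
Fact F01_sub_neq0 (u : F01) : 1 - val u != 0.
Proof. by case/andP: (valP u) => _; rewrite subr_eq0 eq_sym. Qed.

Definition delta_gen (u : F01) : wedge2 (Fstar F) :=
  wedge (star (F01_neq0 u)) (star (F01_sub_neq0 u)).

Definition delta_free : {freeg F01} -> wedge2 (Fstar F) := free_lift delta_gen.
HB.instance Definition _ := GRing.Additive.on delta_free.

Lemma delta_free_fgen x (x0 : x != 0) (x1 : 1 - x != 0) :
  delta_free (fgen x) = wedge (star x0) (star x1).
Proof.
rewrite /fgen; case: insubP => [u _ ux|]; last first.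
  by rewrite x0 eq_sym -subr_eq0 x1.
rewrite /delta_free free_liftU /delta_gen.
by congr wedge; apply: val_inj; rewrite /= ux.
Qed.

Lemma delta_free_five_term r : five_term_rel r -> delta_free r = 0.
Proof.
case=> x [y [[x0 x1 y0 y1 xy] ->]].
have c0 : 1 - x != 0 by rewrite subr_eq0 eq_sym.
have d0 : 1 - y != 0 by rewrite subr_eq0 eq_sym.
have e0 : x - y != 0 by rewrite subr_eq0.
have xm : x - 1 != 0 by rewrite subr_eq0.
have ym : y - 1 != 0 by rewrite subr_eq0.
pose a := star x0; pose b := star y0; pose c := star c0; pose d := star d0.
pose e := star e0.
have dE z (u v : Fstar F) : z = val u -> 1 - z = val v ->
    delta_free (fgen z) = wedge u v.
  move=> zu zv; have z0 : z != 0 by rewrite zu (valP u).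
  have z1 : 1 - z != 0 by rewrite zv (valP v).
  by rewrite (delta_free_fgen z0 z1); congr wedge; apply: val_inj.
rewrite /five_term !(raddfB, raddfD) /=.
rewrite (dE x a c) // (dE y b d) // (dE (y / x) (b - a) (e - a)); first last.
- by rewrite val_FstarD val_FstarN /=; field.
- by rewrite val_FstarD val_FstarN.
rewrite (dE ((1 - x) / (1 - y)) (c - d) (e - d)); first last.
- by rewrite val_FstarD val_FstarN /=; field.
- by rewrite val_FstarD val_FstarN.
rewrite (dE ((1 - x^-1) / (1 - y^-1)) ((b - a) + (c - d)) (e - d - a)); first last.
- by rewrite !val_FstarD !val_FstarN /=; field; rewrite x0 y0 d0 ym.
- by rewrite !val_FstarD !val_FstarN /=; field; rewrite x0 y0 d0 ym.
have -> : wedge a c - wedge b d + wedge (b - a) (e - a)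
    - wedge (b - a + (c - d)) (e - d - a) + wedge (c - d) (e - d)
  = wedge a c - wedge b d + wedge (b - a) d + wedge (c - d) a.
  have -> : e - a = (e - d - a) + d by rewrite addrAC subrK.
  rewrite (wedgeDl (b - a) (c - d)) (wedgeDr (b - a)) (wedgeDr (c - d) _ (- a)).
  rewrite wedgeNr.
  have V (A B C D E : wedge2 (Fstar F)) :
      A + (B + C) - (B + (D - E)) + D = A + C + E.
    by rewrite opprD opprB [B + C]addrC !addrA addrK subrK.
  exact: V.
rewrite !(wedgeDl, wedgeNl).
have V (A B C D E : wedge2 (Fstar F)) :
    A - B + (B - C) + (D - E) = (A + D) - (C + E).
  by rewrite [A - B + _]addrA subrK opprD addrACA.
by rewrite V !wedge_anti subrr.
Qed.

Definition delta : preBloch -> wedge2 (Fstar F) := zlift delta_free.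
HB.instance Definition _ := GRing.isZmodMorphism.Build preBloch
  (wedge2 (Fstar F)) delta (zlift_is_zmod_morphism delta_free_five_term).

Lemma delta_bracket x (x0 : x != 0) (x1 : 1 - x != 0) :
  delta (bracket x) = wedge (star x0) (star x1).
Proof.
by rewrite /delta /bracket (zliftE delta_free_five_term) /= delta_free_fgen.
Qed.

Definition bloch : {pred preBloch} := [pred p | delta p == 0].

Lemma bloch_zmod : zmod_closed bloch.
Proof.
split=> [|p q]; first by rewrite inE; apply/eqP; exact: (raddf0 delta).
rewrite [p \in _]inE [q \in _]inE [_ \in _]inE => /eqP dp /eqP dq.
by apply/eqP; rewrite (raddfB delta) /= dp dq subrr.
Qed.
HB.instance Definition _ := GRing.isZmodClosed.Build preBloch bloch bloch_zmod.

(* c_F = [x] + [1 - x] for some x in F \ {0, 1}; by cFE the choice does not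
   matter.  It is 0 for the two-element field, where there is no such x. *)
Definition cF : preBloch :=
  let x := xget 0 [set x : F | x != 0 /\ x != 1]%classic in
  bracket x + bracket (1 - x).

Lemma bracket_compl_indep x y : x != 0 -> x != 1 -> y != 0 -> y != 1 ->
  bracket x + bracket (1 - x) = bracket y + bracket (1 - y).
Proof.
move=> x0 x1 y0 y1; have [-> //|xy] := eqVneq x y.
have c0 : 1 - x != 0 by rewrite subr_eq0 eq_sym.
have d0 : 1 - y != 0 by rewrite subr_eq0 eq_sym.
have xm : x - 1 != 0 by rewrite subr_eq0.
have ym : y - 1 != 0 by rewrite subr_eq0.
have c1 : 1 - x != 1 by rewrite -subr_eq0 addrAC subrr sub0r oppr_eq0.
have d1 : 1 - y != 1 by rewrite -subr_eq0 addrAC subrr sub0r oppr_eq0.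
have dc : 1 - y != 1 - x by rewrite (inj_eq (addrI 1)) eqr_opp eq_sym.
have E1 := bracket_five_term (And5 x0 x1 y0 y1 xy).
have E2 := bracket_five_term (And5 d0 d1 c0 c1 dc).
have e1 : (1 - (1 - y)^-1) / (1 - (1 - x)^-1) = (1 - x^-1) / (1 - y^-1).
  by field; rewrite x0 y0 c0 d0 ym subr_eq0 c1.
have e2 : (1 - (1 - y)) / (1 - (1 - x)) = y / x by rewrite !opprB !(addrC 1) !subrK.
rewrite e1 e2 in E2.
have V (X C Y D q u v : preBloch) :
    X - Y + q - u + v - (D - C + v - u + q) = X + C - (Y + D).
  have -> : X - Y + q - u + v = (X - Y) + (v - u + q).
    by rewrite -!addrA; congr (X + (- Y + _)); rewrite addrCA [RHS]addrCA [q + v]addrC.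
  have -> : D - C + v - u + q = (D - C) + (v - u + q) by rewrite -!addrA.
  by rewrite opprD addrACA subrr addr0 opprB addrACA opprD.
apply/eqP; rewrite -subr_eq0 -(V _ _ _ _ (bracket (y / x))
  (bracket ((1 - x^-1) / (1 - y^-1))) (bracket ((1 - x) / (1 - y)))).
by rewrite E1 E2 subrr.
Qed.

Lemma cFE x : x != 0 -> x != 1 -> cF = bracket x + bracket (1 - x).
Proof.
move=> x0 x1; rewrite /cF.
by case: xgetP => [y _ [y0 y1]|/(_ x)[]//]; apply: bracket_compl_indep.
Qed.

Lemma cF_bloch : (exists x : F, x != 0 /\ x != 1) -> cF \in bloch.
Proof.
case=> x [x0 x1]; rewrite (cFE x0 x1) inE raddfD /=.
have c0 : 1 - x != 0 by rewrite subr_eq0 eq_sym.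
have cc : 1 - (1 - x) != 0 by rewrite opprB addrC subrK.
rewrite (delta_bracket x0 c0) (delta_bracket c0 cc).
have -> : star cc = star x0 by apply: val_inj; rewrite /= opprB addrC subrK.
by rewrite wedge_anti.
Qed.

End Bloch.

Arguments bloch F : clear implicits.
Arguments cF F : clear implicits.

Definition has_order (G : zmodType) (x : G) (n : nat) : Prop :=
  [/\ (0 < n)%N, x *+ n = 0 & forall m, (0 < m)%N -> x *+ m = 0 -> (n <= m)%N].

(* Q(sqrt(-7)) inside the complex (algebraic) numbers: subFExtend adjoins
   sqrt(-7) = i sqrt(7), a root of X^2 + 7, to the image of rat in algC.  Its
   elements are mapped into algC by subfx_inj. *)
Definition csqrtm7 : algC := 'i * sqrtC 7.

Definition Qsqrtm7 : fieldType :=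
  subFExtend (ratr : {rmorphism rat -> algC}) csqrtm7 ('X^2 + 7%:P).

Definition Qsqrtm7_inj : Qsqrtm7 -> algC :=
  @subfx_inj rat algC (ratr : {rmorphism rat -> algC}) csqrtm7 ('X^2 + 7%:P).
HB.instance Definition _ := GRing.RMorphism.on Qsqrtm7_inj.

Definition sqrtm7 : Qsqrtm7 :=
  subfx_root (ratr : {rmorphism rat -> algC}) csqrtm7 ('X^2 + 7%:P).

Lemma sqrtm7E : Qsqrtm7_inj sqrtm7 = csqrtm7.
Proof.
apply: subfx_inj_root.
  rewrite rootE rmorphD /= map_polyXn map_polyC /= !hornerE /csqrtm7.
  by rewrite exprMn sqrCi sqrtCK mulN1r ratr_nat addNr.
by rewrite -size_poly_eq0 size_polyDl ?size_polyXn // ltnS (leq_trans (size_polyC_leq1 _)).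
Qed.

Definition w12 : Qsqrtm7 := 3 / 8 + sqrtm7 / 8.
Definition w21 : Qsqrtm7 := 5 / 4 + sqrtm7 / 4.
Definition w34 : Qsqrtm7 := 3 / 8 - sqrtm7 / 8.
Definition w43 : Qsqrtm7 := 5 / 4 - sqrtm7 / 4.

Definition t12 : Qsqrtm7 := 3 / 2 + sqrtm7 / 2.
Definition t21 : Qsqrtm7 := - (1 / 4) - sqrtm7 / 4.
Definition t34 : Qsqrtm7 := 3 / 2 - sqrtm7 / 2.
Definition t43 : Qsqrtm7 := - (1 / 4) + sqrtm7 / 4.

Lemma rmorph_quadE (K L : fieldType) (f : {rmorphism K -> L}) (r : K) (s i : L)
    (m n k : nat) : f r = i * s ->
  [/\ f (m%:R / n%:R + r / k%:R) = m%:R / n%:R + s / k%:R * i,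
      f (m%:R / n%:R - r / k%:R) = m%:R / n%:R - s / k%:R * i,
      f (- (m%:R / n%:R) + r / k%:R) = - (m%:R / n%:R) + s / k%:R * i
    & f (- (m%:R / n%:R) - r / k%:R) = - (m%:R / n%:R) - s / k%:R * i].
Proof.
move=> fr; have E : f (r / k%:R) = s / k%:R * i.
  by rewrite rmorphM fmorphV rmorph_nat fr /= -mulrA mulrC.
have E' : f (m%:R / n%:R) = m%:R / n%:R by rewrite rmorphM fmorphV !rmorph_nat.
by split; rewrite ?rmorphB ?rmorphD ?rmorphN /= E E'.
Qed.

Lemma w12E : Qsqrtm7_inj w12 = 3 / 8 + sqrtC 7 / 8 * 'i.
Proof. by case: (rmorph_quadE 3 8 8 sqrtm7E). Qed.
Lemma w21E : Qsqrtm7_inj w21 = 5 / 4 + sqrtC 7 / 4 * 'i.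
Proof. by case: (rmorph_quadE 5 4 4 sqrtm7E). Qed.
Lemma w34E : Qsqrtm7_inj w34 = 3 / 8 - sqrtC 7 / 8 * 'i.
Proof. by case: (rmorph_quadE 3 8 8 sqrtm7E). Qed.
Lemma w43E : Qsqrtm7_inj w43 = 5 / 4 - sqrtC 7 / 4 * 'i.
Proof. by case: (rmorph_quadE 5 4 4 sqrtm7E). Qed.

Lemma t12E : Qsqrtm7_inj t12 = 3 / 2 + sqrtC 7 / 2 * 'i.
Proof. by case: (rmorph_quadE 3 2 2 sqrtm7E). Qed.
Lemma t21E : Qsqrtm7_inj t21 = - (1 / 4) - sqrtC 7 / 4 * 'i.
Proof. by case: (rmorph_quadE 1 4 4 sqrtm7E). Qed.
Lemma t34E : Qsqrtm7_inj t34 = 3 / 2 - sqrtC 7 / 2 * 'i.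
Proof. by case: (rmorph_quadE 3 2 2 sqrtm7E). Qed.
Lemma t43E : Qsqrtm7_inj t43 = - (1 / 4) + sqrtC 7 / 4 * 'i.
Proof. by case: (rmorph_quadE 1 4 4 sqrtm7E). Qed.

Definition beta1 : preBloch Qsqrtm7 :=
  (bracket w12 + bracket w21 + bracket w34 + bracket w43) *+ 2.
Definition beta2 : preBloch Qsqrtm7 :=
  (bracket t12 + bracket t21 + bracket t34 + bracket t43) *+ 2.

(* Main.v *)
(** Write [w = (1 + sqrt(-7)) / 2] and [w' = 1 - w], so that [w * w' = 2] and
[- w ^+ 2 = 1 + w'].  Then [w12 = - w ^- 2], [w21 = 1 / (1 - w12)],
[t34 = - w ^+ 2], [t43 = - 1 / w], and the other four numbers are their
conjugates.  Since [cF = [x] + [1 - x]] and [2 ([x] + [1/x]) = 0], both sums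
reduce to [4 ([- w] + [- w'])], which the five-term relation at [(w, -1)]
evaluates as [4 cF]; the relation [6 cF = 0] then gives (1) and (2).

For [2 cF <> 0], let [v] be the valuation at the prime [w] above 2.  Its residue
field is [F_2], so exactly one of [v x > 0 = v (1 - x)],
[v x = v (1 - x) < 0], [v x = 0 < v (1 - x)] holds, and a case check shows
that [[x] |-> sgn (v x)] respects the five-term relation modulo 3.  It
sends [cF] to [1]. *)
From HB Require Import structures.
Require Import Defs.
From mathcomp Require Import all_boot all_order all_algebra.
From mathcomp Require Import all_field classical_sets freeg ring lra zify.

Set Implicit Arguments.
Unset Strict Implicit.
Unset Printing Implicit Defensive.

Import Order.TTheory GRing.Theory Num.Theory.

Local Open Scope ring_scope.

(** * The valuation at a prime above 2 *)

Section Valuation.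
Variables (F : fieldType) (w : F).
Hypothesis w2 : w ^+ 2 = w - 2.
Hypothesis intr_eq0 : forall n : int, n%:~R = 0 :> F -> n = 0.
Hypothesis span_w : forall x : F,
  exists a b d : int, d != 0 /\ x * d%:~R = a%:~R + b%:~R * w.

(** For [F = Q(sqrt(-7))] these elements form the ring of integers, in which [w] generates a prime
    above 2. *)
Definition qint (a b : int) : F := a%:~R + b%:~R * w.

Lemma qintM a b c d :
  qint a b * qint c d = qint (a * c - 2 * b * d) (a * d + b * c + b * d).
Proof.
have E0 : w ^+ 2 - (w - 2) = 0 by rewrite w2 subrr.
apply/eqP; rewrite -subr_eq0; apply/eqP.
rewrite -[RHS](mulr0 (b%:~R * d%:~R)) -E0 /qint !(rmorphD, rmorphB, rmorphM) /=.
ring.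
Qed.

Lemma qintB a b c d : qint a b - qint c d = qint (a - c) (b - d).
Proof. by rewrite /qint !rmorphB /=; ring. Qed.

(** Multiplying by the conjugate [qint (a + b) (- b)] gives the norm, and four times the norm is
    [(2 * a + b) ^+ 2 + 7 * b ^+ 2]. *)
Lemma qint_eq0 a b : qint a b = 0 -> a = 0 /\ b = 0.
Proof.
move=> E; have := qintM a b (a + b) (- b); rewrite E mul0r => /esym.
have -> : a * (- b) + b * (a + b) + b * (- b) = 0 by ring.
rewrite /qint mulr0z mul0r addr0 => /intr_eq0 N.
have : (2 * a + b) ^+ 2 + 7 * b ^+ 2 = 0.
  by rewrite -[RHS](mulr0 4) -N; ring.
move=> H; have /eqP : b ^+ 2 = 0 by have := sqr_ge0 (2 * a + b); have := sqr_ge0 b; lra.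
rewrite sqrf_eq0 => /eqP b0; move: H; rewrite b0 expr0n mulr0 !addr0 => /eqP.
by rewrite sqrf_eq0 mulf_eq0 => /eqP.
Qed.

(** As [w * (1 - w) = 2], reduction modulo [w] sends [a + b * w] to the parity of [a], so the odd
    elements are those outside the prime [w]. *)
Definition odd_qint (p : F) := exists a b, p = qint (2 * a + 1) b.
Definition even_qint (p : F) := exists a b, p = qint (2 * a) b.

Lemma odd_even_qint p : odd_qint p -> ~ even_qint p.
Proof.
case=> a [b ->] [c [d /eqP]]; rewrite -subr_eq0 qintB => /eqP/qint_eq0[]; lia.
Qed.

Lemma odd_qint_neq0 p : odd_qint p -> p != 0.
Proof. by case=> a [b ->]; apply/eqP => /qint_eq0[]; lia. Qed.

Lemma odd_qint1 : odd_qint 1.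
Proof. by exists 0, 0; rewrite /qint mul0r addr0. Qed.

Lemma odd_qintM p q : odd_qint p -> odd_qint q -> odd_qint (p * q).
Proof.
move=> [a [b ->]] [c [d ->]]; rewrite qintM.
exists (2 * a * c + a + c - b * d), ((2 * a + 1) * d + b * (2 * c + 1) + b * d).
by congr qint; ring.
Qed.

Lemma w_qint a b : w * qint a b = qint (- (2 * b)) (a + b).
Proof.
have -> : w = qint 0 1 by rewrite /qint add0r mul1r.
by rewrite qintM; congr qint; ring.
Qed.

Lemma even_qint_wX n p : odd_qint p -> even_qint (w ^+ n.+1 * p).
Proof.
case=> a [b ->]; elim: n => [|n [c [d IHn]]].
  by rewrite expr1 w_qint; exists (- b), (2 * a + 1 + b); congr qint; ring.
rewrite exprS -mulrA IHn w_qint.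
by exists (- d), (2 * c + d); congr qint; ring.
Qed.

Lemma w_neq0 : w != 0.
Proof.
by have := w_qint 0 (-1); case: eqP => // -> /esym; rewrite mul0r => /qint_eq0[].
Qed.

(* Since [w * (1 - w) = 2], the element [2 * c + b * w] is
   [w * (b + c - c * w)], and dividing by [w] halves the norm
   [a ^+ 2 + a * b + 2 * b ^+ 2]. *)
Lemma qint_wX a b : qint a b != 0 ->
  exists n q, odd_qint q /\ qint a b = w ^+ n * q.
Proof.
have [m] : exists m : nat, a ^+ 2 + a * b + 2 * b ^+ 2 < m%:Z.
  by exists (absz (a ^+ 2 + a * b + 2 * b ^+ 2)).+1; lia.
elim: m a b => [|m IHm] a b lt_m ab0; first by exfalso; nia.
have [c [ac|ac]] : exists c, a = 2 * c \/ a = 2 * c + 1.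
  by exists (a %/ 2)%Z; lia.
- have E : qint a b = w * qint (b + c) (- c) by rewrite w_qint ac; congr qint; ring.
  have [||n [q [oq Eq]]] := IHm (b + c) (- c).
  (* Halving strictly decreases the norm because the norm is positive. *)
  + have : 0 < a ^+ 2 + a * b + 2 * b ^+ 2.
      have : ~ (a = 0 /\ b = 0).
        by case=> a0 b0; move: ab0; rewrite a0 b0 /qint mul0r addr0 eqxx.
      nia.
    by rewrite ac in lt_m *; nia.
  + by apply: contraNneq ab0 => E0; rewrite E E0 mulr0.
  by exists n.+1, q; split=> //; rewrite E Eq exprS mulrA.
by exists 0, (qint a b); split; [exists c, b; rewrite ac | rewrite mul1r].
Qed.

(** Odd elements are units at [w], so [n] is the valuation of [x]. As a relation, it allows
    existence and uniqueness to be proved before [wval] picks a value. *)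
Definition has_val (x : F) (n : int) :=
  exists p q, [/\ odd_qint p, odd_qint q & x = w ^ n * p / q].

Lemma has_valM x y m n : has_val x m -> has_val y n -> has_val (x * y) (m + n).
Proof.
move=> [p [q [op oq ->]]] [r [s [or os ->]]]; exists (p * r), (q * s).
split; [exact: odd_qintM|exact: odd_qintM|].
rewrite expfzDr ?w_neq0 // invfM; ring.
Qed.

Lemma has_valV x n : has_val x n -> has_val x^-1 (- n).
Proof.
move=> [p [q [op oq ->]]]; exists q, p; split=> //.
by rewrite !invfM invrK -invr_expz; ring.
Qed.

Lemma has_val_neq0 x n : has_val x n -> x != 0.
Proof.
move=> [p [q [op oq ->]]].
apply: mulf_neq0; last by rewrite invr_eq0 odd_qint_neq0.
by apply: mulf_neq0 (odd_qint_neq0 op); apply: expfz_neq0; apply: w_neq0.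
Qed.

(** A positive exponent would make the odd denominator [q] even; inversion reduces negative
    exponents to positive ones. *)
Lemma has_val1 n : has_val 1 n -> n = 0.
Proof.
suff pos k : ~ has_val 1 k.+1%:Z.
  by case: n => [[|k /pos]|k /has_valV] //; rewrite invr1 NegzE opprK => /pos.
case=> p [q [op oq /eqP]].
rewrite eq_sym -subr_eq0 -(inj_eq (mulIf (odd_qint_neq0 oq))) mul0r mulrBl.
rewrite divfK ?odd_qint_neq0 // mul1r subr_eq0 => /eqP E.
by apply: (odd_even_qint oq); rewrite -E; apply: even_qint_wX.
Qed.

Lemma has_val_uniq x m n : has_val x m -> has_val x n -> m = n.
Proof.
move=> xm xn; have := has_valM xm (has_valV xn).
by rewrite mulfV ?(has_val_neq0 xm) // => /has_val1; lia.
Qed.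

Lemma has_val_qint a b : qint a b != 0 -> exists n : nat, has_val (qint a b) n.
Proof.
move=> /qint_wX[n [q [oq ->]]]; exists n, q, 1.
by split=> //; [exact: odd_qint1 | rewrite divr1].
Qed.

Lemma has_val_exists x : x != 0 -> exists n, has_val x n.
Proof.
move=> x0; have [a [b [d [d0 E]]]] := span_w x.
have dF0 : d%:~R != 0 :> F by apply: contra_neq d0; apply: intr_eq0.
have Ed : d%:~R = qint d 0 by rewrite /qint mul0r addr0.
have [|m vm] := @has_val_qint a b; first by rewrite /qint -E mulf_neq0.
have [|n vn] := @has_val_qint d 0; first by rewrite -Ed.
exists (m%:Z - n%:Z); have -> : x = qint a b / d%:~R by rewrite /qint -E mulfK.
by rewrite Ed; apply: has_valM => //; apply: has_valV.
Qed.

Lemma has_val_opp1 : has_val (-1) 0.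
Proof.
exists (-1), 1; split; [|exact: odd_qint1|by rewrite mul1r divr1].
by exists (-1), 0; rewrite /qint; ring.
Qed.

Lemma even_qintB p q : odd_qint p -> odd_qint q -> even_qint (p - q).
Proof.
by move=> [a [b ->]] [c [d ->]]; exists (a - c), (b - d); rewrite qintB; congr qint; ring.
Qed.

Lemma odd_qintB p q : odd_qint p -> even_qint q -> odd_qint (p - q).
Proof.
by move=> [a [b ->]] [c [d ->]]; exists (a - c), (b - d); rewrite qintB; congr qint; ring.
Qed.

Lemma has_val_compl_pos x n : 0 < n -> has_val x n -> has_val (1 - x) 0.
Proof.
case: n => // -[//|n] _ [p [q [op oq ->]]]; exists (q - w ^+ n.+1 * p), q.
split=> //; first by apply: odd_qintB => //; apply: even_qint_wX.
by rewrite mul1r mulrBl divff ?odd_qint_neq0.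
Qed.

(** The residue field [F_2] enters here: in [1 - x = (q - p) / q] the difference of two odd elements
    is even, hence divisible by [w]. *)
Lemma has_val_compl_eq0 x n : x != 1 -> has_val x 0 -> has_val (1 - x) n -> 0 < n.
Proof.
move=> x1 [p [q [op oq Ex]]].
have q0 := odd_qint_neq0 oq.
have Ey : 1 - x = (q - p) / q by rewrite Ex mul1r mulrBl divff.
have [a [b Eqp]] := even_qintB oq op.
have qp0 : qint (2 * a) b != 0.
  by rewrite -Eqp subr_eq0; apply: contraNneq x1 => E; rewrite Ex mul1r -E divff.
have [[|m] [r [or Er]]] := qint_wX qp0.
  by case: (odd_even_qint or); exists a, b; rewrite Er mul1r.
move=> /(@has_val_uniq _ m.+1%:Z) <- //.
by exists r, q; split=> //; rewrite Ey Eqp Er.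
Qed.

(* [wval 0 = 0] is a junk value. *)
Definition wval (x : F) : int := xget 0 [set n | has_val x n]%classic.

Lemma wvalP x : x != 0 -> has_val x (wval x).
Proof.
move=> /has_val_exists[n xn]; rewrite /wval.
by case: xgetP => [m _ //|/(_ n)].
Qed.

Lemma wval_eq x n : has_val x n -> wval x = n.
Proof. by move=> xn; apply: has_val_uniq (wvalP (has_val_neq0 xn)) xn. Qed.

Lemma wvalM x y : x != 0 -> y != 0 -> wval (x * y) = wval x + wval y.
Proof. by move=> x0 y0; apply: wval_eq; apply: has_valM; apply: wvalP. Qed.

Lemma wval_compl x : x != 0 -> x != 1 ->
  [\/ 0 < wval x /\ wval (1 - x) = 0, wval x < 0 /\ wval (1 - x) = wval x
    | wval x = 0 /\ 0 < wval (1 - x)].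
Proof.
move=> x0 x1; have vx := wvalP x0.
have y0 : 1 - x != 0 by rewrite subr_eq0 eq_sym.
have [v0|v0|v0] := ltgtP (wval x) 0.
- apply: Or32; split=> //; apply: wval_eq.
  (* This factorization reduces negative valuation to the positive case, applied to [x^-1]. *)
  have -> : 1 - x = (-1) * x * (1 - x^-1) by field.
  have nv0 : 0 < - wval x by lia.
  have := has_valM (has_valM has_val_opp1 vx) (has_val_compl_pos nv0 (has_valV vx)).
  by rewrite add0r addr0.
- by apply: Or31; split=> //; apply: wval_eq; apply: has_val_compl_pos vx.
- by apply: Or33; split=> //; rewrite v0 in vx; apply: has_val_compl_eq0 (wvalP y0).
Qed.

End Valuation.

(** * Detection of [cF] by a valuation *)

Section Detection.
Variables (F : fieldType) (v : F -> int).
Hypothesis vM : forall x y, x != 0 -> y != 0 -> v (x * y) = v x + v y.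
Hypothesis v_compl : forall x, x != 0 -> x != 1 ->
  [\/ 0 < v x /\ v (1 - x) = 0, v x < 0 /\ v (1 - x) = v x
    | v x = 0 /\ 0 < v (1 - x)].

Lemma val_div x y : x != 0 -> y != 0 -> v (x / y) = v x - v y.
Proof.
move=> x0 y0; have := @vM (x / y) y; rewrite divfK // => -> //.
  by rewrite addrK.
by rewrite mulf_neq0 ?invr_eq0.
Qed.

(** Here [m], [m'] stand for the values of [v] at [x], [1 - x], and [n], [n'] for those at [y],
    [1 - y]. The integer sum need not vanish: it is [-3] when [m < 0 < n]. *)
Lemma sgz_five_term (m n m' n' : int) :
  [\/ 0 < m /\ m' = 0, m < 0 /\ m' = m | m = 0 /\ 0 < m'] ->
  [\/ 0 < n /\ n' = 0, n < 0 /\ n' = n | n = 0 /\ 0 < n'] ->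
  (sgz m - sgz n + sgz (n - m) - sgz (m' - m - (n' - n)) + sgz (m' - n'))%:~R
    = 0 :> 'I_3.
Proof.
move=> Hm Hn.
case: Hm => -[hm hm']; case: Hn => -[hn hn'];
case: (sgzP m) => ?; try (exfalso; lia); case: (sgzP n) => ?; try (exfalso; lia);
case: (sgzP (n - m)) => ?; try (exfalso; lia);
case: (sgzP (m' - m - (n' - n))) => ?; try (exfalso; lia);
case: (sgzP (m' - n')) => ?; try (exfalso; lia); exact/val_inj.
Qed.

Definition vsign (u : F01 F) : 'I_3 := (sgz (v (val u)))%:~R.

Lemma free_lift_fgen x : x != 0 -> x != 1 ->
  free_lift vsign (fgen x) = (sgz (v x))%:~R.
Proof.
move=> x0 x1; rewrite /fgen; case: insubP => [u _ ux|]; last by rewrite x0 x1.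
by rewrite free_liftU /vsign ux.
Qed.

Lemma free_lift_five_term r : five_term_rel r -> free_lift vsign r = 0.
Proof.
case=> x [y [xy ->]].
case: (five_term_args xy) => /andP[a0 a1] /andP[b0 b1] /andP[c0 c1].
case: xy => x0 x1 y0 y1 xy.
have xc : 1 - x != 0 by rewrite subr_eq0 eq_sym.
have yc : 1 - y != 0 by rewrite subr_eq0 eq_sym.
(* The two signs cancel in the quotient, whose valuation then depends only on those of [x], [y],
   [1 - x] and [1 - y]. *)
have Ex (z : F) : z != 0 -> 1 - z^-1 = (-1) * ((1 - z) / z) by move=> z0; field.
have E : (1 - x^-1) / (1 - y^-1) = ((1 - x) / x) / ((1 - y) / y).
  by rewrite !Ex // -mulf_div divff ?mul1r // oppr_eq0 oner_eq0.
rewrite /five_term !(raddfB, raddfD) /= !free_lift_fgen // E !val_div //.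
  by rewrite -!(rmorphB, rmorphD) /=; apply: sgz_five_term; apply: v_compl.
all: by rewrite mulf_neq0 ?invr_eq0.
Qed.

Lemma cF_mul2_neq0 x : 0 < v x -> x != 0 -> x != 1 -> cF F *+ 2 <> 0.
Proof.
move=> vx x0 x1 E.
have lift_add := zlift_is_zmod_morphism free_lift_five_term.
pose h : {additive preBloch F -> 'I_3} :=
  HB.pack (zlift (free_lift vsign) : preBloch F -> 'I_3)
    (GRing.isZmodMorphism.Build (preBloch F) 'I_3 _ lift_add).
have hE z : z != 0 -> z != 1 -> h (bracket z) = (sgz (v z))%:~R.
  move=> z0 z1; rewrite -[LHS]/(zlift (free_lift vsign) (zproj _ (fgen z))).
  by rewrite (zliftE free_lift_five_term) /= free_lift_fgen.
have c0 : 1 - x != 0 by rewrite subr_eq0 eq_sym.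
have c1 : 1 - x != 1 by rewrite -subr_eq0 addrAC subrr sub0r oppr_eq0.
have := congr1 h E; rewrite (cFE x0 x1) (raddfMn h) (raddf0 h) (raddfD h) !hE //.
have -> : v (1 - x) = 0 by case: (v_compl x0 x1) => -[] //; lia.
by rewrite gtr0_sgz // sgz0 => /(congr1 val).
Qed.

End Detection.

(** * Consequences of the five-term relation *)

Section Relations.
Variable F : fieldType.
Implicit Types x y u v : F.

(** The defect of the inversion relation [[1/x] = - [x]]. *)
Definition psi x : preBloch F := bracket x + bracket x^-1.

Lemma psiV x : psi x^-1 = psi x.
Proof. by rewrite /psi invrK addrC. Qed.

(* Add the five-term relations at [(x, y)] and [(y, x)], with [x] and [y] chosen
   so that [y / x = u] and [(1 - x) / (1 - y) = v]. *)
Lemma psiM u v : u != 0 -> u != 1 -> v != 0 -> v != 1 -> u * v != 1 ->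
  psi (u * v) = psi u + psi v.
Proof.
move=> u0 u1 v0 v1 uv1.
have d0 : u * v - 1 != 0 by rewrite subr_eq0.
pose x := (v - 1) / (u * v - 1); pose y := u * x.
have vm : v - 1 != 0 by rewrite subr_eq0.
have um : u - 1 != 0 by rewrite subr_eq0.
have x0 : x != 0 by rewrite mulf_neq0 ?invr_eq0.
have y0 : y != 0 by rewrite mulf_neq0.
have xc : 1 - x != 0.
  have -> : 1 - x = (u - 1) * v / (u * v - 1) by rewrite /x; field.
  by rewrite !mulf_neq0 ?invr_eq0.
have yc : 1 - y != 0.
  have -> : 1 - y = (u - 1) / (u * v - 1) by rewrite /y /x; field.
  by rewrite !mulf_neq0 ?invr_eq0.
have xy : x != y.
  by rewrite -subr_eq0 /y -[X in X - _]mul1r -mulrBl mulf_neq0 // subr_eq0 eq_sym.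
have x1 : x != 1 by rewrite eq_sym -subr_eq0.
have y1 : y != 1 by rewrite eq_sym -subr_eq0.
have yx : y != x by rewrite eq_sym.
have E1 := bracket_five_term (And5 x0 x1 y0 y1 xy).
have E2 := bracket_five_term (And5 y0 y1 x0 x1 yx).
have Eu : y / x = u by rewrite /y mulfK.
have Ev : (1 - x) / (1 - y) = v.
  rewrite /y /x; field; rewrite d0.
  by have -> : u * v - 1 - u * (v - 1) = u - 1 by ring.
have xm : x - 1 != 0 by rewrite subr_eq0.
have ym : y - 1 != 0 by rewrite subr_eq0.
have Euv : (1 - x^-1) / (1 - y^-1) = u * v.
  by rewrite -Eu -Ev; field; rewrite x0 y0 yc ym.
have EuV : x / y = u^-1 by rewrite -Eu invf_div.
have EvV : (1 - y) / (1 - x) = v^-1 by rewrite -Ev invf_div.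
have EuvV : (1 - y^-1) / (1 - x^-1) = (u * v)^-1 by rewrite -Euv [RHS]invf_div.
rewrite Eu Ev Euv in E1; rewrite EuV EvV EuvV in E2.
(* The terms in [x] and [y] occur with opposite signs in [EW] and [EWV], so they cancel in the
   sum. *)
have EW : bracket (u * v) = (bracket x - bracket y) + (bracket u + bracket v).
  apply/eqP; rewrite -subr_eq0 -oppr_eq0 opprB; apply/eqP.
  by rewrite -[RHS]E1 addrA [RHS]addrAC.
have EWV : bracket (u * v)^-1 = (bracket y - bracket x) + (bracket u^-1 + bracket v^-1).
  apply/eqP; rewrite -subr_eq0 -oppr_eq0 opprB; apply/eqP.
  by rewrite -[RHS]E2 addrA [RHS]addrAC.
by rewrite /psi EW EWV addrACA -(opprB (bracket x)) subrr add0r addrACA.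
Qed.

(** Writing [u] as [(u * v) / v] and applying [psiM] twice gives [psi u = psi u + psi v + psi v],
    because [psi v^-1 = psi v]. *)
Lemma psi_mul2 u v : u != 0 -> u != 1 -> v != 0 -> v != 1 ->
  u != v -> u * v != 1 -> psi v *+ 2 = 0.
Proof.
move=> u0 u1 v0 v1 uv uv1.
have vV0 : v^-1 != 0 by rewrite invr_eq0.
have vV1 : v^-1 != 1 by rewrite invr_eq1.
have uV1 : u / v != 1 by rewrite -(inj_eq (mulIf v0)) divfK // mul1r.
have E : psi u = psi u + psi v + psi v.
  rewrite -{1}(mulfK v0 u) psiM ?mulf_neq0 ?mulfK // psiV.
  by rewrite psiM.
by apply: (addrI (psi u)); rewrite addr0 mulr2n addrA -E.
Qed.

(** * Torsion relations in characteristic zero *)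

Section CharZero.
Hypothesis natr_neq0 : forall n, n.+1%:R != 0 :> F.

(** One of 2 and 3 always serves as the auxiliary element [u] of [psi_mul2]. *)
Lemma psi2 x : x != 0 -> x != 1 -> psi x *+ 2 = 0.
Proof.
move=> x0 x1.
have n1 n : n.+2%:R != 1 :> F.
  by rewrite -subr_eq0 -[1]/(1%:R) -natrB // subn1 natr_neq0.
have neq m n : (m < n)%N -> m%:R != n%:R :> F.
  move=> lt_mn; rewrite eq_sym -subr_eq0 -natrB ?(ltnW lt_mn) //.
  by rewrite -subn_gt0 in lt_mn; rewrite -(prednK lt_mn).
suff [k [kx kx1]] : exists k, k.+2%:R != x /\ k.+2%:R * x != 1 by exact: psi_mul2 kx kx1.
have inj a b : a.+2%:R * x = 1 -> b.+2%:R * x = 1 -> a.+2%:R = b.+2%:R :> F.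
  by move=> Ea Eb; apply: (mulIf x0); rewrite Ea Eb.
have [E2|N2] := eqVneq 2%:R x.
  by exists 1; rewrite -E2 -natrM !n1 eq_sym neq.
have [F2|M2] := eqVneq (2%:R * x) 1; last by exists 0.
have [E3|N3] := eqVneq 3%:R x.
  by move/eqP: F2; rewrite -E3 -natrM (negPf (n1 4)).
exists 1; split=> //; apply/eqP => F3; have /eqP := inj 0 1 F2 F3.
by rewrite (negPf (neq _ _ _)).
Qed.

Lemma two_neq1 : 2 != 1 :> F.
Proof. by rewrite -subr_eq0 (_ : 2 - 1 = 1) ?oner_neq0 //; ring. Qed.

Lemma opp1_neq1 : -1 != 1 :> F.
Proof. by rewrite eq_sym -addr_eq0; exact: (natr_neq0 1). Qed.

Lemma opp1_neq0 : -1 != 0 :> F.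
Proof. by rewrite oppr_eq0 oner_neq0. Qed.

Lemma bracket_opp1 : bracket (-1 : F) *+ 4 = 0.
Proof.
have := psi2 opp1_neq0 opp1_neq1.
by rewrite /psi invrN invr1 -mulr2n -mulrnA.
Qed.

(* Evaluating [cF] at [1 / 2] and at [2] gives [cF *+ 3 = psi (-1)]. *)
Lemma cF_mul6 : cF F *+ 6 = 0.
Proof.
have two0 : 2 != 0 :> F := natr_neq0 1.
have Eh : cF F = bracket (2^-1) *+ 2.
  rewrite (@cFE _ 2^-1) ?invr_eq0 ?invr_eq1 ?two_neq1 // mulr2n.
  by congr (_ + bracket _); field.
have E2 : cF F = bracket 2 + bracket (-1).
  by rewrite (@cFE _ 2) ?two_neq1 //; congr (_ + bracket _); ring.
have := psi2 two0 two_neq1; rewrite /psi mulrnDl -Eh => E.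
have -> : cF F *+ 6 = (cF F *+ 3) *+ 2 by rewrite -mulrnA.
have -> : cF F *+ 3 = bracket (-1) *+ 2.
  by rewrite mulrS {2}E2 mulrnDl addrA [_ + bracket 2 *+ 2]addrC E add0r.
by rewrite -mulrnA bracket_opp1.
Qed.

Lemma opp_cF_mul2_bloch x : x != 0 -> x != 1 -> - (cF F *+ 2) \in bloch F.
Proof. by move=> x0 x1; rewrite rpredN rpredMn // cF_bloch //; exists x. Qed.

Lemma bracketV_mul2 x : x != 0 -> x != 1 -> bracket x^-1 *+ 2 = - (bracket x *+ 2).
Proof.
by move=> x0 x1; apply/eqP; rewrite -addr_eq0 addrC -mulrnDl; apply/eqP/psi2.
Qed.

Lemma bracketV_mul4 x : x != 0 -> x != 1 -> bracket x^-1 *+ 4 = - (bracket x *+ 4).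
Proof. by move=> x0 x1; rewrite !(mulrnA _ 2 2) bracketV_mul2 // mulNrn. Qed.

Lemma bracket_complE x : x != 0 -> x != 1 -> bracket (1 - x) = cF F - bracket x.
Proof. by move=> x0 x1; rewrite (cFE x0 x1) addrAC subrr add0r. Qed.

(** Inversion followed by complement; it relates [w21] to [w12] and [w43] to [w34]. *)
Lemma bracket_rot_mul2 x : x != 0 -> x != 1 ->
  bracket (1 - x)^-1 *+ 2 = bracket x *+ 2 - cF F *+ 2.
Proof.
move=> x0 x1; rewrite bracketV_mul2 ?bracket_complE ?mulrnBl ?opprB //.
  by rewrite subr_eq0 eq_sym.
by rewrite -subr_eq0 addrAC subrr sub0r oppr_eq0.
Qed.

(** * Bracket identities for the conjugate roots [w] and [1 - w] of [X^2 - X + 2] *)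

Definition quad7 (w : F) := w ^+ 2 = w - 2.

Lemma quad7C w : quad7 w -> quad7 (1 - w).
Proof. by rewrite /quad7 sqrrB expr1n mul1r => ->; ring. Qed.

Lemma quad7_mul w : quad7 w -> w * (1 - w) = 2.
Proof. by move=> w2; rewrite mulrBr mulr1 -expr2 w2; ring. Qed.

Lemma quad7_neq w : quad7 w -> [/\ w != 0, w != 1, 1 - w != 0 & 1 + w != 0].
Proof.
move=> w2; have : w * (1 - w) != 0 by rewrite quad7_mul // (natr_neq0 1).
rewrite mulf_eq0 negb_or => /andP[w0 c0]; split=> //.
  by rewrite eq_sym -subr_eq0.
(* The conjugate of [1 + w] is [2 - w], and their product is 4. *)
have : (1 + w) * (2 - w) != 0.
  have -> : (1 + w) * (2 - w) = 2 + w - w ^+ 2 by ring.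
  by rewrite w2 (_ : _ - _ = 4%:R) ?natr_neq0 //; ring.
by rewrite mulf_eq0 negb_or => /andP[].
Qed.

Lemma quad7_sqr w : quad7 w -> - w ^+ 2 = 1 - - (1 - w).
Proof. by move=> ->; ring. Qed.

Lemma quad7_opp_neq w : quad7 w ->
  [/\ - w != 0, - w != 1, - w ^+ 2 != 0 & - w ^+ 2 != 1].
Proof.
move=> qw; have [w0 w1 c0 u0] := quad7_neq qw.
rewrite !oppr_eq0 expf_neq0 //; split=> //.
  by rewrite eq_sym -subr_eq0 opprK.
by rewrite quad7_sqr // -subr_eq0 addrAC subrr sub0r opprK.
Qed.

Lemma bracket_opp_sqr w : quad7 w -> bracket (- w ^+ 2) = cF F - bracket (- (1 - w)).
Proof.
by move=> qw; have [u0 u1 _ _] := quad7_opp_neq (quad7C qw);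
  rewrite quad7_sqr // bracket_complE.
Qed.

Lemma bracket_opp_sqrV w : quad7 w ->
  bracket (- w ^+ 2)^-1 *+ 4 = bracket (- (1 - w)) *+ 4 - cF F *+ 4.
Proof.
move=> qw; have [_ _ u0 u1] := quad7_opp_neq qw.
by rewrite bracketV_mul4 // bracket_opp_sqr // mulrnBl opprB.
Qed.

(* The five-term relation at [(w, -1)], where [(1 - w) / 2 = w^-1]. *)
Lemma bracket_opp_conj w : quad7 w ->
  bracket (- w) *+ 4 + bracket (- (1 - w)) *+ 4 = cF F *+ 4.
Proof.
move=> qw; have [w0 w1 c0 u0] := quad7_neq qw.
have [n0 n1 _ _] := quad7_opp_neq qw.
have wm1 : w != -1 by rewrite -addr_eq0 addrC.
have two0 : 2 != 0 :> F := natr_neq0 1.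
have E := bracket_five_term (And5 w0 w1 opp1_neq0 opp1_neq1 wm1).
have Ea : -1 / w = (- w)^-1 by rewrite invrN mulN1r.
have Eb : (1 - w) / (1 - -1) = w^-1.
  by rewrite opprK -[1 + 1]/(2%:R) -(quad7_mul qw) invfM mulrCA divff // mulr1.
have Ec : (1 - w^-1) / (1 - (-1)^-1) = (- w ^+ 2)^-1.
  have -> : 1 - w^-1 = - ((1 - w) / w) by field.
  rewrite invrN invr1 mulNr mulrAC Eb invrN.
  by rewrite expr2 invfM.
rewrite Ea Eb Ec in E.
(* Multiplying by 4 kills [[-1]] and turns inversion into a change of sign, so [[w]] and [[w^-1]]
   cancel. *)
have H := congr1 (fun z => z *+ 4) E; rewrite /= !(mulrnDl, mulNrn) mul0rn in H.
rewrite bracket_opp1 subr0 bracket_opp_sqrV // !bracketV_mul4 // opprB in H.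
rewrite addrAC [X in X + _]addrAC subrr add0r in H.
apply/eqP; rewrite eq_sym -subr_eq0 -H opprD addrA; apply/eqP.
by rewrite addrA [X in _ = X - _]addrC.
Qed.

Lemma bracket_opp_sqrV_rot w : quad7 w -> let x := (- w ^+ 2)^-1 in
  (bracket x + bracket (1 - x)^-1) *+ 2
    = bracket (- (1 - w)) *+ 4 - cF F *+ 4 - cF F *+ 2.
Proof.
move=> qw x; have [_ _ u0 u1] := quad7_opp_neq qw.
rewrite mulrnDl bracket_rot_mul2 ?invr_eq0 ?invr_eq1 // addrA -mulrnDr.
by rewrite bracket_opp_sqrV.
Qed.

Lemma bracket_sum_w w : quad7 w ->
  let x := (- w ^+ 2)^-1 in let y := (- (1 - w) ^+ 2)^-1 in
  (bracket x + bracket (1 - x)^-1 + (bracket y + bracket (1 - y)^-1)) *+ 2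
    = - (cF F *+ 2).
Proof.
move=> qw x y; rewrite mulrnDl bracket_opp_sqrV_rot //.
rewrite bracket_opp_sqrV_rot ?subKr; last exact: quad7C.
rewrite addrACA (addrACA (bracket _ *+ 4)) [X in X + _ + _]addrC bracket_opp_conj //.
(* The coefficient of [cF] is [4 - 8 - 4 = - (2 + 6)], which is [-2] modulo 6. *)
rewrite [X in X + _]addrA subrr add0r -!opprD -!mulrnDr -[(4 + (2 + 2))%N]/(2 + 6)%N.
by rewrite mulrnDr cF_mul6 addr0.
Qed.

(** Complements replace the squares and inversion changes signs, leaving [4 cF - 4 ([- w] +
    [- (1 - w)])]. *)
Lemma bracket_sum_t w : quad7 w ->
  (bracket (- (1 - w) ^+ 2) + bracket (- (1 - w))^-1
    + (bracket (- w ^+ 2) + bracket (- w)^-1)) *+ 2 = 0.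
Proof.
move=> qw; have qc := quad7C qw.
have [a0 a1 _ _] := quad7_opp_neq qw; have [b0 b1 _ _] := quad7_opp_neq qc.
rewrite !bracket_opp_sqr // subKr (addrACA (cF F - _)).
rewrite (addrACA (cF F)) -mulr2n -opprD mulrnDl [X in _ + X]mulrnDl !bracketV_mul2 //.
rewrite -opprD -mulrnDl [bracket (- (1 - w)) + _]addrC mulrnBl -mulrnA.
by rewrite -addrA -opprD -mulrnDr -(bracket_opp_conj qw) -mulrnDl subrr.
Qed.
Lemma quad7_sqrt s : s ^+ 2 = - 7 -> quad7 ((1 + s) / 2).
Proof.
move=> s2; have two0 : 2 != 0 :> F := natr_neq0 1.
rewrite /quad7; apply/eqP; rewrite -subr_eq0; apply/eqP.
have E : s ^+ 2 + 7 = 0 by rewrite s2 addNr.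
by rewrite -[RHS](mul0r (4%:R^-1)) -E; field; rewrite two0 natr_neq0.
Qed.

Lemma bracket_sums s : s ^+ 2 = - 7 ->
  (bracket (3 / 8 + s / 8) + bracket (5 / 4 + s / 4)
    + bracket (3 / 8 - s / 8) + bracket (5 / 4 - s / 4)) *+ 2 = - (cF F *+ 2)
  /\ (bracket (3 / 2 + s / 2) + bracket (- (1 / 4) - s / 4)
    + bracket (3 / 2 - s / 2) + bracket (- (1 / 4) + s / 4)) *+ 2 = 0.
Proof.
move=> s2; have qw := quad7_sqrt s2; set w := (1 + s) / 2 in qw.
have s27 : s ^+ 2 + 7 = 0 by rewrite s2 addNr.
have two0 : 2 != 0 :> F := natr_neq0 1.
have four0 : 4 != 0 :> F := natr_neq0 3; have eight0 : 8 != 0 :> F := natr_neq0 7.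
have Ec : 1 - w = (1 - s) / 2 by rewrite /w; field.
(* Since [field] does not know that [s ^+ 2 = - 7], each inverse is certified by the explicit
   multiple [k] of [s ^+ 2 + 7] in [x * y - 1]. *)
have invE (x y : F) k : x * y - 1 = k * (s ^+ 2 + 7) -> x = y^-1.
  rewrite s27 mulr0 => /eqP; rewrite subr_eq0 => /eqP xy.
  have y0 : y != 0 by apply/eqP => y0; move/eqP: xy; rewrite y0 mulr0 eq_sym oner_eq0.
  by apply: (mulIf y0); rewrite xy mulVf.
have Ew : - w ^+ 2 = (3 - s) / 2 by rewrite qw /w; field.
have Ewc : - (1 - w) ^+ 2 = (3 + s) / 2 by rewrite (quad7C qw) Ec; field.
have -> : 3 / 8 + s / 8 = (- w ^+ 2)^-1.
  by rewrite Ew; apply: (invE _ _ (- 16%:R^-1)); field; rewrite !natr_neq0.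
have -> : 3 / 8 - s / 8 = (- (1 - w) ^+ 2)^-1.
  by rewrite Ewc; apply: (invE _ _ (- 16%:R^-1)); field; rewrite !natr_neq0.
have -> : 5 / 4 + s / 4 = (1 - (- w ^+ 2)^-1)^-1.
  rewrite Ew invf_div (_ : 2 / (3 - s) = (3 + s) / 8).
    by apply: (invE _ _ (- 32%:R^-1)); field; rewrite !natr_neq0.
  by rewrite -invf_div; apply/esym/(invE _ _ (- 16%:R^-1)); field; rewrite !natr_neq0.
have -> : 5 / 4 - s / 4 = (1 - (- (1 - w) ^+ 2)^-1)^-1.
  rewrite Ewc invf_div (_ : 2 / (3 + s) = (3 - s) / 8).
    by apply: (invE _ _ (- 32%:R^-1)); field; rewrite !natr_neq0.
  by rewrite -invf_div; apply/esym/(invE _ _ (- 16%:R^-1)); field; rewrite !natr_neq0.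
have -> : - (1 / 4) - s / 4 = (- (1 - w))^-1.
  by rewrite Ec; apply: (invE _ _ (- 8%:R^-1)); field; rewrite !natr_neq0.
have -> : - (1 / 4) + s / 4 = (- w)^-1.
  by rewrite /w; apply: (invE _ _ (- 8%:R^-1)); field; rewrite !natr_neq0.
have -> : 3 / 2 + s / 2 = - (1 - w) ^+ 2 by rewrite Ewc; field.
have -> : 3 / 2 - s / 2 = - w ^+ 2 by rewrite Ew; field.
by split; rewrite -addrA ?bracket_sum_w ?bracket_sum_t.
Qed.

End CharZero.
End Relations.

(** * The field [Q(sqrt(-7))] *)

Lemma Qsqrtm7_intr_eq0 (n : int) : n%:~R = 0 :> Qsqrtm7 -> n = 0.
Proof.
move=> /(congr1 Qsqrtm7_inj); rewrite rmorph_int rmorph0 => /eqP.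
by rewrite intr_eq0 => /eqP.
Qed.

Lemma Qsqrtm7_natr_neq0 n : n.+1%:R != 0 :> Qsqrtm7.
Proof. by apply/eqP => /(@Qsqrtm7_intr_eq0 n.+1%:Z). Qed.

Lemma sqrtm7_sqr : sqrtm7 ^+ 2 = - 7 :> Qsqrtm7.
Proof.
apply: (fmorph_inj Qsqrtm7_inj); rewrite rmorphXn /= sqrtm7E rmorphN rmorph_nat.
by rewrite /csqrtm7 exprMn sqrCi sqrtCK mulN1r.
Qed.

Definition omega : Qsqrtm7 := (1 + sqrtm7) / 2.

Lemma omega_quad7 : quad7 omega.
Proof. exact: (quad7_sqrt Qsqrtm7_natr_neq0 sqrtm7_sqr). Qed.

(** Every element is a rational polynomial in [sqrtm7 = 2 * omega - 1]; Horner induction clears the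
    denominator of one coefficient at a time. *)
Lemma Qsqrtm7_span (x : Qsqrtm7) :
  exists a b d : int, d != 0 /\ x * d%:~R = a%:~R + b%:~R * omega.
Proof.
have two0 := Qsqrtm7_natr_neq0 1.
have dF (d : int) : d != 0 -> d%:~R != 0 :> Qsqrtm7.
  by apply: contra_neq; apply: Qsqrtm7_intr_eq0.
have Es : sqrtm7 = 2 * omega - 1 by rewrite /omega; field.
pose ev : {rmorphism {poly rat} -> Qsqrtm7} :=
  subfx_eval (ratr : {rmorphism rat -> algC}) csqrtm7 ('X^2 + 7%:P).
have [p ->] : exists p, x = ev p := subfxE x.
have evX : ev 'X = sqrtm7 by [].
elim/poly_ind: p => [|p c [a [b [d [d0 E]]]]].
  by exists 0, 0, 1; split=> //; rewrite rmorph0 !mul0r addr0.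
have Ec : ev c%:P * (denq c)%:~R = (numq c)%:~R.
  by rewrite -!(rmorph_int ev) -rmorphM /= -!(rmorph_int polyC) -polyCM -numqE.
have w2 : omega * omega = omega - 2 by rewrite -expr2 omega_quad7.
(* These come from [(a + b * omega) * (2 * omega - 1) = - (a + 4 * b) + (2 * a + b) * omega]. *)
exists (- (a + 4 * b) * denq c + numq c * d), ((2 * a + b) * denq c), (d * denq c).
split; first by rewrite mulf_neq0 ?denq_neq0.
rewrite rmorphD rmorphM evX Es; move: (ev p) (ev c%:P) E Ec => r s E Ec.
have -> : (r * (2 * omega - 1) + s) * (d * denq c)%:~R
   = r * d%:~R * (2 * omega - 1) * (denq c)%:~R + s * (denq c)%:~R * d%:~R.
  by rewrite rmorphM /=; ring.
rewrite Ec E; apply/eqP; rewrite -subr_eq0; apply/eqP.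
rewrite -[RHS](mulr0 (2 * b%:~R * (denq c)%:~R)) -(subrr (omega - 2)) -{1}w2.
by ring.
Qed.

Lemma cF_Qsqrtm7_mul2_neq0 : cF Qsqrtm7 *+ 2 <> 0.
Proof.
have [w0 w1 _ _] := quad7_neq Qsqrtm7_natr_neq0 omega_quad7.
have hv : has_val omega omega 1.
  exists 1, 1; split; [exact: odd_qint1|exact: odd_qint1|].
  by rewrite expr1z mulr1 divr1.
have v_omega : 0 < wval omega omega.
  by rewrite (wval_eq omega_quad7 Qsqrtm7_intr_eq0 Qsqrtm7_span hv).
apply: (cF_mul2_neq0 _ _ v_omega w0 w1).
  exact: (wvalM omega_quad7 Qsqrtm7_intr_eq0 Qsqrtm7_span).
exact: (wval_compl omega_quad7 Qsqrtm7_intr_eq0 Qsqrtm7_span).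
Qed.

Lemma has_order3_opp_mul2 (G : zmodType) (c : G) :
  c *+ 6 = 0 -> c *+ 2 <> 0 -> has_order (- (c *+ 2)) 3.
Proof.
move=> c6 c2; have b3 : - (c *+ 2) *+ 3 = 0 by rewrite mulNrn -mulrnA c6 oppr0.
split=> // -[|[|[|m]]] // _ => [/eqP|b2].
  by rewrite mulr1n oppr_eq0 => /eqP.
(* An element killed by both 2 and 3 is zero. *)
by case: c2; apply: oppr_inj; rewrite oppr0 -[LHS]addr0 -{1}b2 -mulrS.
Qed.

Theorem proposition5p2 :
  [/\ beta1 = - (cF Qsqrtm7 *+ 2),
      beta2 = 0
    & [/\ beta1 \in bloch Qsqrtm7, beta1 <> 0 & has_order beta1 3]].
Proof.
have two_neq0 : 2 != 0 :> Qsqrtm7 := Qsqrtm7_natr_neq0 1.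
have c2 := cF_Qsqrtm7_mul2_neq0; have c6 := cF_mul6 Qsqrtm7_natr_neq0.
have [E1 E2] := bracket_sums Qsqrtm7_natr_neq0 sqrtm7_sqr.
have {}E1 : beta1 = - (cF Qsqrtm7 *+ 2) := E1.
split; [exact: E1 | exact: E2 | rewrite E1; split].
- exact: (opp_cF_mul2_bloch two_neq0 (two_neq1 _)).
- by move/eqP; rewrite oppr_eq0 => /eqP.
- exact: has_order3_opp_mul2 c6 c2.
Qed.
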